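(* $\mathfrak{ros}(c_0)=\min(\mathfrak{d},\mathfrak{r})$.
   Context: Scalars are either all real or all complex. For $A\subseteq\mathbb{N}$ let $P_A$ be the operator $f\mapsto f\cdot 1_A$ (multiplication by the characteristic function of $A$), acting on $c_0$. Let $\mathcal{B}_0(c_0)$ be the set of bounded linear operators $T:c_0\to c_0$ with zero diagonal, i.e. $T(1_{\{n\}})(n)=0$ for all $n\in\mathbb{N}$. For $T\in\mathcal{B}_0(c_0)$ and $\varepsilon>0$ let $Ros_{T,\varepsilon}=\{A\subseteq\mathbb{N}\text{ infinite}:\|P_ATP_A\|\le\varepsilon\|T\|\}$. $\mathfrak{ros}(c_0)$ is the minimal cardinality of a family $\mathcal{G}$ of infinite subsets of $\mathbb{N}$ such that $\mathcal{G}\cap Ros_{T,\varepsilon}\neq\emptyset$ for all $T\in\mathcal{B}_0(c_0)$ and $\varepsilon>0$. $\mathfrak{d}$ is the dominating number (minimal size of a family of functions $\mathbb{N}\to\mathbb{N}$ such that every function $\mathbb{N}\to\mathbb{N}$ is eventually dominated by a member of the family). The reaping number $\mathfrak{r}$ is the minimal cardinality of a family $\mathcal{F}$ of infinite subsets of $\mathbb{N}$ such that there is no $S\subseteq\mathbb{N}$ with $F\cap S$ and $F\setminus S$ both infinite for all $F\in\mathcal{F}$. *)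

(* Defs.v *)
From HB Require Import structures.
From mathcomp Require Import all_boot all_order all_algebra.
From mathcomp Require Import all_classical all_reals all_analysis.
From mathcomp Require Import complex.

Set Implicit Arguments.
Unset Strict Implicit.
Unset Printing Implicit Defensive.
Import Order.TTheory GRing.Theory Num.Theory.
Import numFieldNormedType.Exports.

Local Open Scope classical_set_scope.
Local Open Scope ring_scope.
Local Open Scope card_scope.

Section C0.
Variable K : numFieldType.

Definition c0_pred : {pred nat -> K^o} :=
  mem [set f : nat -> K^o | f @ \oo --> (0 : K^o)].

Lemma c0_predP (f : nat -> K^o) : f \in c0_pred <-> f @ \oo --> (0 : K^o).
Proof. by rewrite inE. Qed.

Lemma c0_submod_closed : submod_closed c0_pred.
Proof.
split=> [|a f g /c0_predP f0 /c0_predP g0]; apply/c0_predP.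
  exact: cvg_cst.
have -> : (0 : K^o) = a *: 0 + 0 by rewrite scaler0 addr0.
by apply: cvgD g0; apply: cvgZr.
Qed.

HB.instance Definition _ :=
  GRing.isSubmodClosed.Build _ _ c0_pred c0_submod_closed.

Record c0 := C0 { c0_val :> nat -> K^o ; c0_valP : c0_val \in c0_pred }.

HB.instance Definition _ := [isSub for c0_val].
HB.instance Definition _ := [Choice of c0 by <:].
HB.instance Definition _ := [SubChoice_isSubLmodule of c0 by <:].

Lemma c0_eqP (f g : c0) : (forall n, f n = g n) -> f = g.
Proof. by move=> fg; apply/val_inj/funext. Qed.

Lemma c0_cvg (f : c0) : f n @[n --> \oo] --> (0 : K^o).
Proof. exact/c0_predP/c0_valP. Qed.

Definition c0_norm (f : c0) : K := supremum 0 (range (fun n => `|f n| : K)).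

Lemma c0_max (f : c0) : exists m, forall n, `|f n| <= `|f m|.
Proof.
have [f0|/existsNP[m0 /eqP fm0]] := pselect (forall n, f n = 0).
  by exists 0%N => n; rewrite !f0.
have [N _ fN] : \forall n \near \oo, `|f n| < `|f m0|.
  by have /cvgr0Pnorm_lt := @c0_cvg f; apply; rewrite normr_gt0.
have [m fm] : exists m, forall n, (n < (maxn N m0).+1)%N -> `|f n| <= `|f m|.
  elim: (maxn N m0).+1 => [|k [m fm]]; first by exists 0%N.
  have [fkm|fmk] := real_leP (normr_real (f k)) (normr_real (f m)).
    exists m => n; rewrite ltnS leq_eqVlt => /predU1P[->//|]; exact: fm.
  exists k => n; rewrite ltnS leq_eqVlt => /predU1P[->//|/fm nm].
  exact: le_trans nm (ltW fmk).
exists m => n; have [nN|Nn] := ltnP n N.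
  by apply: fm; rewrite ltnS (leq_trans (ltnW nN))// leq_maxl.
apply: le_trans (ltW (fN n Nn)) _.
by apply: fm; rewrite ltnS leq_maxr.
Qed.

Lemma c0_norm_max (f : c0) :
  (forall n, `|f n| <= c0_norm f) /\ exists m, c0_norm f = `|f m|.
Proof.
have [m fm] := c0_max f.
suff -> : c0_norm f = `|f m| by split => //; exists m.
rewrite /c0_norm /supremum ifF; last first.
  by apply/negbTE/set0P; exists `|f m|; exists m.
apply: xget_unique => [|y [yub ylb]].
  split=> [_ [n _ <-]|y]; first exact: fm.
  by apply; exists m.
apply/le_anti; rewrite yub ?andbT; last by exists m.
by apply: ylb => _ [n _ <-]; exact: fm.
Qed.

Lemma c0_normD (f g : c0) : c0_norm (f + g) <= c0_norm f + c0_norm g.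
Proof.
have [_ [m ->]] := c0_norm_max (f + g).
apply: le_trans (ler_normD _ _) _.
by apply: lerD; apply: (c0_norm_max _).1.
Qed.

Lemma c0_normZ (a : K) (f : c0) : c0_norm (a *: f) = `|a| * c0_norm f.
Proof.
apply/le_anti/andP; split.
  have [_ [m ->]] := c0_norm_max (a *: f); rewrite [`|_|]normrM.
  by rewrite ler_wpM2l// (c0_norm_max f).1.
have [_ [m ->]] := c0_norm_max f.
by have := (c0_norm_max (a *: f)).1 m; rewrite [`|_ m|]normrM.
Qed.

Lemma c0_norm_eq0 (f : c0) : c0_norm f = 0 -> f = 0.
Proof.
move=> f0; apply: c0_eqP => n; apply/eqP; rewrite -normr_le0 -f0.
exact: (c0_norm_max f).1.
Qed.

HB.instance Definition _ :=
  Lmodule_isNormed.Build K c0 c0_normD c0_normZ c0_norm_eq0.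

Lemma c0_normE (f : c0) : `|f| = supremum 0 (range (fun n => `|f n| : K)).
Proof. by []. Qed.

Lemma c0P_subproof (A : set nat) (f : c0) :
  (fun n => f n * \1_A n : K^o) \in c0_pred.
Proof.
apply/c0_predP/cvgr0Pnorm_lt => e e0.
have /cvgr0Pnorm_lt/(_ e e0) := @c0_cvg f; apply: filterS => n; apply: le_lt_trans.
by rewrite normrM indicE; case: (n \in A); rewrite ?normr1 ?mulr1// normr0 mulr0.
Qed.

Definition c0P (A : set nat) (f : c0) : c0 := C0 (c0P_subproof A f).

Lemma c0P_linear A : linear (c0P A).
Proof.
by move=> a f g; apply: c0_eqP => n; rewrite /= mulrDl -scalerAl.
Qed.

HB.instance Definition _ A := GRing.isLinear.Build K c0 c0 _ (c0P A) (c0P_linear A).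

Lemma c0_delta_subproof (k : nat) : (\1_[set k] : nat -> K^o) \in c0_pred.
Proof.
apply/c0_predP/cvgr0Pnorm_lt => e e0; exists k.+1 => // n /= kn.
rewrite indicE memNset ?normr0//= => nk; by rewrite nk ltnn in kn.
Qed.

Definition c0_delta (k : nat) : c0 := C0 (c0_delta_subproof k).

Definition bounded_operator (T : {linear c0 -> c0}) :=
  exists M : K, forall f, `|T f| <= M * `|f|.

(* [supremum] is the least upper bound for the order of [K]; when [K] is [R[i]]
   that order restricts to the usual one on the reals, see [supremumsR] and
   [supremumsC] below. *)
Definition op_norm (T : c0 -> c0) : K :=
  supremum 0 [set `|T f| | f in [set f | `|f| <= 1]].

Definition B0 : set {linear c0 -> c0} :=
  [set T | bounded_operator T /\ forall n, T (c0_delta n) n = 0].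

Definition Ros (T : {linear c0 -> c0}) (eps : K) : set (set nat) :=
  [set A | infinite_set A /\ op_norm (c0P A \o T \o c0P A) <= eps * op_norm T].

Definition ros_family (G : set (set nat)) :=
  G `<=` [set A | infinite_set A] /\
  forall T (eps : K), B0 T -> 0 < eps -> G `&` Ros T eps !=set0.

End C0.

Lemma supremumsR (R : realType) (A : set R) :
  A !=set0 -> has_ubound A -> supremums A !=set0.
Proof.
move=> A0 ubA; exists (sup A); split; first exact: sup_upper_bound.
by move=> y Ay; exact: ge_sup.
Qed.

Lemma supremumsC (R : realType) (A : set R[i]) :
  A `<=` [set z | 0 <= z] -> A !=set0 -> has_ubound A -> supremums A !=set0.
Proof.
move=> Age0 A0 [M AM].
have AE z : A z -> z = (complex.Re z)%:C%C.
  by move=> /Age0 /= /ger0_Im; case: z => a b /= ->.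
pose B : set R := @complex.Re R @` A.
have [s [sub slb]] : supremums B !=set0.
  apply: supremumsR.
    by have [z Az] := A0; exists (complex.Re z), z.
  by exists (complex.Re M) => _ [z /AM + <-]; rewrite lecE => /andP[].
exists s%:C%C; split=> [z Az|y Ay].
  by rewrite (AE _ Az) lecR; apply: sub; exists z.
rewrite lecE /=; apply/andP; split.
  have [z Az] := A0; have := Ay _ Az; rewrite (AE _ Az) lecE /=.
  by case/andP.
apply: slb => _ [z Az <-].
by have := Ay _ Az; rewrite lecE => /andP[].
Qed.

Definition dominating_family (D : set (nat -> nat)) :=
  forall f : nat -> nat, exists2 g, D g & \forall n \near \oo, (f n <= g n)%N.

Definition reaping_family (F : set (set nat)) :=
  F `<=` [set A | infinite_set A] /\
  ~ exists S : set nat, forall A, F A ->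
      infinite_set (A `&` S) /\ infinite_set (A `\` S).

(* A cardinal number is represented by a type of that cardinality:
   [min_card P] by the elements of a chosen smallest set satisfying [P]. *)
Definition min_set T (P : set (set T)) : set T :=
  xget set0 [set F | P F /\ forall G, P G -> F #<= G].

Definition min_card T (P : set (set T)) : Type := set_type (min_set P).

Lemma min_setP T (P : set (set T)) : P !=set0 ->
  P (min_set P) /\ forall G, P G -> min_set P #<= G.
Proof.
move=> [G0 PG0]; rewrite /min_set; apply: (@xgetPex _ set0
  [set F | P F /\ forall G, P G -> F #<= G]).
pose apart (M : set (set T -> T)) :=
  (forall f G, M f -> P G -> G (f G)) /\
  (forall f g G, M f -> M g -> P G -> f G = g G -> f = g).
have [|M [[MG Minj] Mmax]] := @Zorn_bigcup _ apart.
  move=> C CP Ctot; split=> [f G [X CX Xf]|f g G [X CX Xf] [Y CY Yg]].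
    by have [H _] := CP _ CX; apply: H.
  have [XY|YX] := Ctot _ _ CX CY.
    by have [_ H] := CP _ CY; apply: H => //; exact: XY.
  by have [_ H] := CP _ CX; apply: H => //; exact: YX.
have [G PG GM] : exists2 G, P G & G `<=` [set f G | f in M].
  apply: contrapT => nG.
  have [h hP] : {h : set T -> T & forall G, P G ->
      G (h G) /\ ~ [set f G | f in M] (h G)}.
    have x0 : T.
      have /existsNP/cid[x _] // : ~ G0 `<=` [set f G0 | f in M].
      by move=> GM; apply: nG; exists G0.
    apply: (@choice _ _ (fun G x => P G -> G x /\ ~ [set f G | f in M] x)) => G.
    have [PG|nPG] := pselect (P G); last by exists x0.
    have /existsNP[x /not_implyP[Gx Mx]] : ~ G `<=` [set f G | f in M].
      by move=> GM; apply: nG; exists G.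
    by exists x.
  have Mh : ~ M h by move=> Mh; have [_] := hP _ PG0; apply; exists h.
  apply: (Mmax (h |` M)).
    split=> [|/(_ h (or_introl erefl))//]; exact: subsetUr.
  split=> [f G [->|Mf] PG|f g G [->|Mf] [->|Mg] PG fg //].
  - exact: (hP _ PG).1.
  - exact: (MG _ _ Mf PG).
  - by have [_] := hP _ PG; case; exists g.
  - by have [_] := hP _ PG; case; exists f.
  - exact: (Minj _ _ _ Mf Mg PG fg).
exists G; split=> // H PH.
apply: (@card_le_trans _ _ _ M).
  apply: card_le_trans (card_image_le (fun f => f G) M).
  exact: subset_card_le.
have [f] : $|{injfun M >-> H}|.
  apply/injfunPex; exists (fun f => f H) => [f Mf|f g /set_mem Mf /set_mem Mg].
    exact: (MG _ _ Mf PH).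
  exact: (Minj _ _ _ Mf Mg PH).
exact: inj_card_le.
Qed.

Definition card_min (A B : Type) : Type :=
  if `[< [set: A] #<= [set: B] >] then A else B.

Definition dominating_number : Type := min_card dominating_family.

Definition reaping_number : Type := min_card reaping_family.

Definition ros_number (K : numFieldType) : Type := min_card (@ros_family K).

(* Main.v *)
Require Import Defs.
From HB Require Import structures.
From mathcomp Require Import all_boot all_order all_algebra.
From mathcomp Require Import all_classical all_reals all_analysis.
From mathcomp Require Import complex zify ring.

Set Implicit Arguments.
Unset Strict Implicit.
Unset Printing Implicit Defensive.
Import Order.TTheory GRing.Theory Num.Theory.
Import numFieldNormedType.Exports.

Local Open Scope classical_set_scope.
Local Open Scope ring_scope.
Local Open Scope card_scope.

(* An operator [T] on c_0 is a matrix [t i j = |T(1_{j})(i)|] with bounded row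
   sums and columns tending to 0, and the norm of [P_A T P_A] is at most [e] as
   soon as every row indexed by [A] has sum at most [e] over [A].

   ros <= d: a set [A] growing faster than a function [f] read off from [T] makes
   both the columns before and the rows after each element of [A] negligible.

   ros <= r: the natural numbers can be coloured with finitely many colours so that
   the row sums inside each colour are small, and a reaping family yields, at no
   cost in cardinality, sets homogeneous for all finite colourings.

   min(d, r) <= ros: if [G] is smaller than both d and r, splitting repeatedly
   gives disjoint sets [B n] all meeting each [A] in [G] infinitely often, and a
   function [h] dominated by none of those read off from [G] selects finite
   pieces of the [B n] such that each [A] contains some [n] and some [i] in the
   [n]-th piece; the operator [T f i = f n] for [i] in the [n]-th piece then
   satisfies [|P_A T P_A| >= 1 >= |T|]. *)

(** * Infinite cardinals *)

(** [min_setP] picks a smallest member of the family consisting of [A] and [B]. *)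
Lemma card_le_total T (A B : set T) : A #<= B \/ B #<= A.
Proof.
have [[->|->] H] := @min_setP _ (fun Z => Z = A \/ Z = B) (ex_intro _ A (or_introl erefl)).
  by left; apply: H; right.
by right; apply: H; left.
Qed.

Lemma card_le_fun T U (A : set T) (B : set U) (u0 : U) : A #<= B ->
  exists2 g : T -> U, (forall x, A x -> B (g x)) &
    (forall x y, A x -> A y -> g x = g y -> x = y).
Proof.
move=> AB; pose U' := HB.pack_for pointedType U (isPointed.Build U u0)
  (gen_eqMixin U) (gen_choiceMixin U).
have /(@pcard_leP _ U') [g] := AB.
by exists g => [x /(@funS _ _ _ _ g) //|x y Ax Ay]; apply: (@inj _ _ _ g); exact/mem_set.
Qed.

Section Pairing.
Variable D : Type.

Let field (G : set (D * D * D)) x := exists z, G (x, x, z).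

(* [G] is the graph of an injection from X * X to X, where X is [field G]. *)
Let pairing (G : set (D * D * D)) :=
  [/\ forall p z z', G (p, z) -> G (p, z') -> z = z',
      forall p p' z, G (p, z) -> G (p', z) -> p = p',
      forall x y z, G (x, y, z) -> [/\ field G x, field G y & field G z] &
      forall x y, field G x -> field G y -> exists z, G (x, y, z)].

Let pairing_fun (G : set (D * D * D)) : pairing G -> D ->
  exists f : D -> D -> D,
   [/\ forall x y z, field G x -> field G y -> G (x, y, z) <-> z = f x y,
       forall x y, field G x -> field G y -> field G (f x y) &
       forall x y x' y', f x y = f x' y' -> field G x -> field G y ->
         field G x' -> field G y' -> x = x' /\ y = y'].
Proof.
move=> [Gf Gi Gs Gt] d0.
have /choice[f fP] : forall p : D * D, exists z, field G p.1 -> field G p.2 -> G (p, z).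
  move=> [x y]; have [[Gx Gy]|n] := pselect (field G x /\ field G y).
    by have [z Gz] := Gt _ _ Gx Gy; exists z.
  by exists d0 => Gx Gy; case: n.
exists (fun x y => f (x, y)); split.
- move=> x y z Gx Gy; split=> [H|->]; last exact: (fP (x, y)).
  by apply: (Gf _ _ _ H); exact: (fP (x, y)).
- by move=> x y Gx Gy; have /Gs[] := fP (x, y) Gx Gy.
- move=> x y x' y' E Gx Gy Gx' Gy'; have H := fP (x, y) Gx Gy.
  by have := fP (x', y') Gx' Gy'; rewrite -E => /(Gi _ _ _ H)[-> ->].
Qed.

(** Zorn's lemma gives a maximal pairing, with field [X]. If the complement of [X] injects into [X],
    so does all of [D], by tagging, and the pairing transfers to [D]. Otherwise [X] has a copy
    inside its complement and the pairing extends to both, against maximality. *)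
Lemma infinite_pairing : infinite_set [set: D] ->
  exists f : D -> D -> D, forall x y x' y', f x y = f x' y' -> x = x' /\ y = y'.
Proof.
move=> Dinf; have [d0 _] := infinite_setN0 Dinf.
have /infiniteP/(card_le_fun d0)[e _ einj'] := Dinf.
have einj : injective e by move=> x y; exact: einj'.
pose G0 := [set q | exists i j, q = (e i, e j, e (pickle (i, j)))] : set (D * D * D).
have G0f i : field G0 (e i) by exists (e (pickle (i, i))); exists i, i.
have G0P : pairing G0.
  split.
  - by move=> p z z' [i [j [-> ->]]] [i' [j' [/einj <- /einj <- ->]]].
  - move=> p p' z [i [j [-> ->]]] [i' [j' [-> /einj]]].
    by move=> /(pcan_inj pickleK)[-> ->].
  - by move=> x y z [i [j [-> -> ->]]].
  - move=> x y [z [i [i' [-> _ _]]]] [z' [j [j' [-> _ _]]]].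
    by exists (e (pickle (i, j))), i, j.
(* Adjoining [G0] to every candidate takes care of the empty chain and keeps the field infinite. *)
have [|M [MP Mmax]] := @Zorn_bigcup _ (fun G => pairing (G0 `|` G)).
  move=> F FP Ftot; pose U := G0 `|` \bigcup_(X in F) X.
  have sub X : F X -> G0 `|` X `<=` U by move=> FX q [?|Xq]; [left|right; exists X].
  have dir q q' : U q -> U q' -> exists G, [/\ pairing G, G `<=` U, G q & G q'].
    move=> [q0|[X FX Xq]] [q0'|[Y FY Yq]].
    - by exists G0; split => // ?; left.
    - by exists (G0 `|` Y); split; [exact: FP|exact: sub|left|right].
    - by exists (G0 `|` X); split; [exact: FP|exact: sub|right|left].
    - have [XY|YX] := Ftot _ _ FX FY.
        by exists (G0 `|` Y); split; [exact: FP|exact: sub|right; apply: XY|right].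
      by exists (G0 `|` X); split; [exact: FP|exact: sub|right|right; apply: YX].
  have fsub G x : G `<=` U -> field G x -> field U x by move=> GU [z /GU]; exists z.
  split.
  - by move=> p z z' Uz Uz'; have [G [[+ _ _ _] _ Gz Gz']] := dir _ _ Uz Uz'; apply; eauto.
  - by move=> p p' z Uz Uz'; have [G [[_ + _ _] _ Gz Gz']] := dir _ _ Uz Uz'; apply; eauto.
  - move=> x y z Uz; have [G [[_ _ + _] GU Gz _]] := dir _ _ Uz Uz.
    by move=> /(_ _ _ _ Gz)[? ? ?]; split; apply: fsub GU _.
  - move=> x y [z Uz] [z' Uz']; have [G [[_ _ _ +] GU Gz Gz']] := dir _ _ Uz Uz'.
    move=> /(_ x y)[||t Gt]; [by exists z|by exists z'|].
    by exists t; apply: GU.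
pose H := G0 `|` M; pose X := field H : set D.
have [f [fP fX finj]] := pairing_fun MP d0.
have Xe i : X (e i) by have [z ?] := G0f i; exists z; left.
have [XY|YX] := card_le_total X (~` X); last first.
  have [g gX ginj] := card_le_fun d0 YX.
  pose q x := if `[< X x >] then f (e 0%N) x else f (e 1%N) (g x).
  have Xq x : X (q x).
    by rewrite /q; case: asboolP => [Xx|/gX Xg]; [exact: fX (Xe _) Xx|exact: fX (Xe _) Xg].
  have qinj : injective q.
    move=> x y; rewrite /q; case: asboolP => Xx; case: asboolP => Xy /finj.
    - by move=> /(_ (Xe _) Xx (Xe _) Xy)[].
    - by move=> /(_ (Xe _) Xx (Xe _) (gX _ Xy))[/einj].
    - by move=> /(_ (Xe _) (gX _ Xx) (Xe _) Xy)[/einj].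
    - by move=> /(_ (Xe _) (gX _ Xx) (Xe _) (gX _ Xy))[_ /ginj]; exact.
  exists (fun x y => f (q x) (q y)) => x y x' y' /finj.
  by move=> /(_ (Xq _) (Xq _) (Xq _) (Xq _))[/qinj -> /qinj ->].
exfalso; have [g gX ginj] := card_le_fun d0 XY.
pose w (b : bool) x := if b then g x else x.
have winj b b' x x' : w b x = w b' x' -> X x -> X x' -> b = b' /\ x = x'.
  move=> E Xx Xx'; case: b E; case: b' => //= E.
  - by have := ginj _ _ Xx Xx' E.
  - by have := gX _ Xx; rewrite E.
  - by have := gX _ Xx'; rewrite -E.
(* Old pairs keep the value [f x x']. New pairs get values in the copy [g] of [X]; the tag
   [b + b'.*2], here 1, 2 or 3, separates their three kinds. *)
pose v b b' x x' := w (b || b') (if b || b' then f (e (b + b'.*2)%N) (f x x') else f x x').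
have Xv b b' x x' : X x -> X x' ->
    X (if b || b' then f (e (b + b'.*2)%N) (f x x') else f x x').
  by move=> Xx Xx'; case: ifP => _; [exact: fX (Xe _) (fX _ _ Xx Xx')|exact: fX Xx Xx'].
have vinj b b' c c' x x' y y' : v b b' x x' = v c c' y y' ->
    X x -> X x' -> X y -> X y' -> [/\ b = c, b' = c', x = y & x' = y'].
  move=> + Xx Xx' Xy Xy' => /winj/(_ (Xv _ _ _ _ Xx Xx') (Xv _ _ _ _ Xy Xy'))[E].
  rewrite E; case: ifP => bb'; last first.
    move=> /finj/(_ Xx Xx' Xy Xy')[-> ->]; move: E.
    by case: b c b' c' bb' => [] [] [] [].
  move/finj/(_ (Xe _) (fX _ _ Xx Xx') (Xe _) (fX _ _ Xy Xy')).
  move=> [/einj E' /finj/(_ Xx Xx' Xy Xy')[-> ->]].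
  by move: E'; case: b c b' c' {bb' E} => [] [] [] [].
pose N := [set q | exists b b' x x', [/\ X x, X x' & q = (w b x, w b' x', v b b' x x')]]
  : set (D * D * D).
have HN : H `<=` N.
  move=> [[x y] z] Hz; have [_ _ Hs _] := MP; have [Xx Xy _] := Hs _ _ _ Hz.
  by exists false, false, x, y; split=> //=; congr (_, _); apply/fP.
have fN b x : X x -> field N (w b x).
  by move=> Xx; exists (v b b x x); exists b, b, x, x.
have Nf x : field N x -> exists b y, X y /\ x = w b y.
  by move=> [z [b [b' [y [y' [Xy _ [-> _ _]]]]]]]; exists b, y.
have G0N : G0 `|` N = N by apply/setUidPr => q qG; apply: HN; left.
apply: (Mmax N).
  split; first by move=> q qM; apply: HN; right.
  move=> NM; have : M (g (e 0%N), g (e 0%N), v true true (e 0%N) (e 0%N)).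
    by apply: NM; exists true, true, (e 0%N), (e 0%N).
  by move=> Mg; apply: (gX _ (Xe 0%N)); exists (v true true (e 0%N) (e 0%N)); right.
rewrite G0N; split.
- move=> p z z' [b [b' [x [x' [Xx Xx' [-> ->]]]]]].
  move=> [c [c' [y [y' [Xy Xy' [/winj E /winj E' ->]]]]]].
  by have [-> ->] := E Xx Xy; have [-> ->] := E' Xx' Xy'.
- move=> p p' z [b [b' [x [x' [Xx Xx' [-> ->]]]]]].
  by move=> [c [c' [y [y' [Xy Xy' [-> /vinj/(_ Xx Xx' Xy Xy')[-> -> -> ->]]]]]]].
- by move=> x y z [b [b' [x1 [x' [Xx Xx' [-> -> ->]]]]]]; split; apply: fN => //; exact: Xv.
- move=> x y /Nf[b [x1 [Xx ->]]] /Nf[b' [x' [Xx' ->]]].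
  by exists (v b b' x1 x'), b, b', x1, x'.
Qed.

(** Lists are coded by nested pairs, tagged [e 0] when empty and [e 1] otherwise. *)
Lemma card_seq_nat_le : infinite_set [set: D] -> [set: seq D * nat] #<= [set: D].
Proof.
move=> Dinf; have [f finj] := infinite_pairing Dinf.
have [d0 _] := infinite_setN0 Dinf.
have /infiniteP/(card_le_fun d0)[e _ einj'] := Dinf.
have einj : injective e by move=> x y; exact: einj'.
pose code := foldr (fun x c => f (e 1%N) (f x c)) (f (e 0%N) (e 0%N)).
have code_inj : injective code.
  elim=> [|x s IH] [|y t] //= /finj[].
  - by move=> /einj.
  - by move=> /einj.
  - by move=> _ /finj[-> /IH ->].
have h_inj : injective (fun p : seq D * nat => f (code p.1) (e p.2)).
  by move=> [s i] [t j] /= /finj[/code_inj -> /einj ->].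
have := @inj_card_eq _ _ setT _ (in2W h_inj).
rewrite card_eq_le => /andP[_ /card_le_trans]; apply; exact: card_leT.
Qed.
End Pairing.

(** * Reaping families *)

Lemma infinite_natP (A : set nat) :
  infinite_set A <-> forall n, exists2 m, A m & (n < m)%N.
Proof.
split=> [Ainf n|Aub /(@finite_seqP nat)[s As]].
  apply: contrapT => An; apply: Ainf.
  apply: (@sub_finite_set _ _ `I_n.+1) (finite_II _) => m Am /=.
  by rewrite ltnS leqNgt; apply/negP => nm; apply: An; exists m.
have [m] := Aub (\max_(i <- s) i)%N; rewrite As /= => ms.
by rewrite ltnNge leq_bigmax_seq.
Qed.

Lemma infinite_next : exists nx : set nat -> nat -> nat,
  forall A n, infinite_set A -> A (nx A n) /\ (n < nx A n)%N.
Proof.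
suff /choice[nx nxP] : forall An : set nat * nat, exists m,
    infinite_set An.1 -> An.1 m /\ (An.2 < m)%N.
  by exists (fun A n => nx (A, n)) => A n /(nxP (A, n)).
move=> [A n]; have [/infinite_natP /(_ n)[m Am nm]|] := pselect (infinite_set A).
  by exists m.
by exists 0%N.
Qed.

Lemma block_index (p : nat -> nat) : p 0%N = 0%N -> (forall k, p k < p k.+1)%N ->
  exists b : nat -> nat, forall i k, (b i == k) = (p k <= i < p k.+1)%N.
Proof.
move=> p0 pS.
have pmono : {homo p : k l / (k <= l)%N}.
  by apply: (homo_leq leqnn leq_trans) => k; exact: ltnW.
have /choice[b bP] : forall i, exists k, (p k <= i < p k.+1)%N.
  elim=> [|i [k /andP[ki ik]]]; first by exists 0%N; rewrite p0 /= -{1}p0.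
  have [ik'|ki'] := ltnP i.+1 (p k.+1); first by exists k; rewrite ik' ltnW.
  by exists k.+1; rewrite ki' (leq_trans _ (pS _))// ltnS.
exists b => i k; have /andP[bi ib] := bP i; apply/eqP/andP => [<-//|[ki ik]].
apply/eqP; rewrite eqn_leq; apply/andP; split; rewrite leqNgt; apply/negP => /pmono lt.
  by have := leq_ltn_trans (leq_trans lt bi) ik; rewrite ltnn.
by have := leq_ltn_trans (leq_trans lt ki) ib; rewrite ltnn.
Qed.

(** For a finite family there is an interval partition each block of which meets every member; the
    union of the odd blocks then splits them all. *)
Lemma reaping_infinite (F : set (set nat)) : reaping_family F -> infinite_set F.
Proof.
move=> [Finf Fr] /(@finite_seqP (set nat))[s Fs]; apply: Fr.
have [nx nxP] := infinite_next.
pose h n := (\max_(A <- s) nx A n)%N.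
have hP A n : F A -> (nx A n <= h n)%N by rewrite Fs => /= As; exact: leq_bigmax_seq.
pose p k := iter k (fun n => (maxn n (h n)).+1) 0%N.
have pS k : (p k < p k.+1)%N by rewrite /= ltnS leq_maxl.
have pge k : (k <= p k)%N by elim: k => // k /leq_ltn_trans; apply.
have [b bP] := block_index (erefl : p 0%N = 0%N) pS.
exists [set i | odd (b i)] => A FA.
have Ab k : exists i, [/\ A i, b i = k & (k < i)%N].
  have [Ai lt] := nxP A (p k) (Finf _ FA).
  exists (nx A (p k)); split=> //; last exact: leq_ltn_trans (pge k) lt.
  by apply/eqP; rewrite bP ltnW//= ltnS (leq_trans (hP _ _ FA))// leq_maxr.
split; apply/infinite_natP => n.
  have [i [Ai bi lt]] := Ab n.*2.+1; exists i; last by lia.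
  by split=> //=; rewrite bi /= odd_double.
have [i [Ai bi lt]] := Ab n.*2; exists i; last by lia.
by split=> //=; rewrite bi odd_double.
Qed.

(* Iterating the members of [F] along their enumerations decides finitely many
   sets at once; infinitude of [F] then makes this cost no extra cardinality. *)
Lemma reaping_homogeneous (F : set (set nat)) : reaping_family F ->
  exists F' : set (set nat), [/\ F' #<= F, forall A, F' A -> infinite_set A &
    forall (X : finType) (c : nat -> X),
      exists2 A, F' A & forall i j, A i -> A j -> c i = c j].
Proof.
move=> Freap; have [Finf Fr] := Freap; have [nx nxP] := infinite_next.
pose e (B : set nat) k := iter k.+1 (nx B) 0%N.
have eB B k : F B -> B (e B k) by move=> /Finf FB; have [] := nxP B (iter k (nx B) 0%N) FB.
have eS B k : F B -> (e B k < e B k.+1)%N.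
  by move=> /Finf FB; have [] := nxP B (iter k.+1 (nx B) 0%N) FB.
have ege B k : F B -> (k <= e B k)%N by move=> FB; elim: k => // k /leq_ltn_trans; apply; exact: eS.
(* The head of the list is applied first, so prepending a member of [F] passes to a subsequence and
   keeps earlier decisions. *)
pose u := foldr (fun (x : F) v k => v (e (set_val x) k)) id : seq F -> nat -> nat.
have uge s k : (k <= u s k)%N.
  elim: s k => //= x s IH k; apply: leq_trans (IH _); apply: ege; exact: set_valP.
have uP (S : nat -> set nat) m : exists s n, forall j, (j < m)%N ->
    (forall k, (n <= k)%N -> S j (u s k)) \/ (forall k, (n <= k)%N -> ~ S j (u s k)).
  elim: m => [|m [s [n IH]]]; first by exists [::], 0%N.
  (* The set [S m] is pulled back along [u s]; as [F] is reaping, the pullback fails to split some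
     [B]. *)
  have [B FB nB] : exists2 B, F B &
      finite_set (B `&` (u s @^-1` S m)) \/ finite_set (B `\` (u s @^-1` S m)).
    apply: contrapT => nB; apply: Fr; exists (u s @^-1` S m) => A FA.
    by split=> fin; apply: nB; exists A => //; [left|right].
  have [N NP] : exists N, (forall b, (N < b)%N -> B b -> S m (u s b)) \/
                          (forall b, (N < b)%N -> B b -> ~ S m (u s b)).
    have bnd Z : finite_set Z -> exists N, forall b, (N < b)%N -> ~ Z b.
      apply: contraPP => /forallNP nN; apply/infinite_natP => N.
      by have /existsNP[b /not_implyP[Nb /contrapT Zb]] := nN N; exists b.
    case: nB => /bnd[N NP]; exists N; [right|left] => b /NP nb Bb.
      by move=> Sb; apply: nb.
    by apply: contrapT => Sb; apply: nb.
  exists (SigSub (mem_set FB) :: s), (maxn n N).+1 => j; rewrite ltnS leq_eqVlt.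
  have ke k : (maxn n N < k)%N -> (n <= e B k)%N /\ (N < e B k)%N.
    by move=> lt; have := ege B k FB; move: lt; lia.
  move=> /predU1P[->|/IH[] H]; [case: NP => H; [left|right] => k /ke[_ lt] /=|left|right].
  - exact: H lt (eB _ _ FB).
  - exact: H lt (eB _ _ FB).
  - by move=> k /ke[nk _]; exact: H.
  - by move=> k /ke[nk _]; exact: H.
exists [set [set u sn.1 k | k in [set k | (sn.2 <= k)%N]] | sn in [set: seq F * nat]].
split.
- apply: card_le_trans (card_image_le _ _) _.
  apply: (@card_le_trans _ _ _ [set: F]).
    apply: card_seq_nat_le; rewrite (eq_finite_set (card_setT F)).
    exact: reaping_infinite.
  by have := card_setT F; rewrite card_eq_le => /andP[].
- move=> _ [[s n] _ <-]; apply/infinite_natP => m.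
  exists (u s (maxn n m.+1)); first by exists (maxn n m.+1) => //=; rewrite leq_maxl.
  by apply: leq_trans (uge _ _); rewrite leq_maxr.
- move=> X c; have [s [n snP]] := uP (fun j => [set i | enum_rank (c i) = j :> nat]) #|X|.
  exists [set u s k | k in [set k | (n <= k)%N]]; first by exists (s, n).
  suff E k : (n <= k)%N -> c (u s k) = c (u s n).
    by move=> _ _ [k /= nk <-] [l /= nl <-]; rewrite !E.
  (* The colour class of [u s n] is decided, and cannot be decided negatively since [u s n] belongs
     to it. *)
  have [H /H|] := snP _ (ltn_ord (enum_rank (c (u s n)))).
    by move=> /= /val_inj/enum_rank_inj.
  by move=> /(_ n (leqnn n))/(_ erefl).
Qed.

(** * Matrices with bounded row sums *)

(* The completeness shared by R and R[i], so that both cases are one. *)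
Definition complete_nneg (K : numFieldType) := forall A : set K,
  A `<=` [set z | 0 <= z] -> A !=set0 -> has_ubound A -> supremums A !=set0.

Section Matrix.
Variable K : numFieldType.
Hypothesis Ksup : complete_nneg K.

(** If all multiples of [d] stayed below [M], their supremum minus [d] would still bound them. *)
Lemma complete_nneg_archi (M d : K) : 0 <= M -> 0 < d -> exists m, M <= d *+ m.+1.
Proof.
move=> M0 d0; apply: contrapT => /forallNP nm.
have [|||s [sub slb]] := @Ksup [set d *+ m.+1 | m in [set: nat]].
- by move=> _ [m _ <-] /=; rewrite mulrn_wge0// ltW.
- by exists (d *+ 1), 0%N.
- exists M => _ [m _ <-]; have dm : 0 <= d *+ m.+1 by rewrite mulrn_wge0// ltW.
  by apply/ltW; rewrite real_ltNge ?ger0_real//; exact/negP/nm.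
have : s <= s - d.
  by apply: slb => _ [m _ <-]; rewrite lerBrDr -mulrSr; apply: sub; exists m.+1.
by rewrite lerDl oppr_ge0 lt_geF.
Qed.

(** Colours are chosen in increasing order of [i]: by averaging, one of the [m.+1] classes formed so
    far carries at most its share of the row sum before [i]. *)
Lemma greedy_coloring (t : nat -> nat -> K) m : (forall i j, 0 <= t i j) ->
  exists c : nat -> 'I_m.+1, forall i,
  (\sum_(0 <= j < i | c j == c i) t i j) *+ m.+1 <= \sum_(0 <= j < i) t i j.
Proof.
move=> t_ge0; have sum_real (P : pred nat) i n : \sum_(0 <= j < n | P j) t i j \is Num.real.
  by apply: ger0_real; apply: sumr_ge0.
have pickP (g : nat -> 'I_m.+1) i : exists x,
    (\sum_(0 <= j < i | g j == x) t i j) *+ m.+1 <= \sum_(0 <= j < i) t i j.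
  apply: contrapT => /forallNP nx.
  have : \sum_(x < m.+1) \sum_(0 <= j < i) t i j <
         \sum_(x < m.+1) (\sum_(0 <= j < i | g j == x) t i j) *+ m.+1.
    apply: ltr_sum; first by apply/hasP; exists ord0; rewrite ?mem_index_enum.
    by move=> x _; rewrite real_ltNge ?rpredMn//; exact/negP/nx.
  rewrite sumr_const card_ord sumrMnl.
  by rewrite -(@partition_big _ _ _ _ _ _ xpredT g xpredT)//= ltxx.
pose pick g i := projT1 (cid (pickP g i)).
(* [hist i] colours the indices below [i]; the value [ord0] elsewhere is a placeholder. *)
pose hist := fix hist i : nat -> 'I_m.+1 :=
  if i is k.+1 then fun j => if j == k then pick (hist k) k else hist k j
  else fun=> ord0.
exists (fun i => hist i.+1 i) => i.
have histE k j : (j < k)%N -> hist k j = hist j.+1 j.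
  elim: k => // k IH; rewrite ltnS leq_eqVlt => /predU1P[->//|jk] /=.
  by rewrite ltn_eqF// IH.
have := projT2 (cid (pickP (hist i) i)); rewrite /= eqxx.
congr (_ *+ _ <= _); rewrite big_nat_cond [RHS]big_nat_cond; apply: eq_bigl => j.
by case: (ltnP j i) => //= ji; rewrite histE.
Qed.

Variable t : nat -> nat -> K.
Hypothesis t_ge0 : forall i j, 0 <= t i j.

Definition small_on (d : K) (A : set nat) :=
  forall i n, A i -> \sum_(0 <= j < n | j \in A) t i j <= d.

Let sum_window (P : pred nat) i a b n :
  \sum_(0 <= j < n | P j && (a <= j < b)%N) t i j <= \sum_(a <= j < b | P j) t i j.
Proof.
rewrite (big_nat_widenl a 0)// (big_nat_widen 0 n (maxn n b)) ?leq_maxl//.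
rewrite [leRHS](big_nat_widen 0 b (maxn n b)) ?leq_maxr//.
rewrite [leLHS]big_mkcond [leRHS]big_mkcond /=; apply: ler_sum => j _.
by case: (P j) (a <= j)%N (j < b)%N (j < n)%N => [] [] [] [] /=.
Qed.

Variable M : K.
Hypothesis t_diag : forall i, t i i = 0.
Hypothesis t_row : forall i n, \sum_(0 <= j < n) t i j <= M.

Let M_ge0 : 0 <= M.
Proof. by have := t_row 0 0; rewrite big_geq. Qed.

(** A partial sum within [d] of the supremum of all partial sums leaves at most [d] for the rest. *)
Lemma row_tail (d : K) i : 0 < d -> exists N, forall n, \sum_(N <= j < n) t i j <= d.
Proof.
move=> d0; have [|||s [sub slb]] := @Ksup [set \sum_(0 <= j < n) t i j | n in [set: nat]].
- by move=> _ [n _ <-]; apply: sumr_ge0.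
- by exists (\sum_(0 <= j < 0) t i j), 0%N.
- by exists M => _ [n _ <-]; exact: t_row.
have s_real : s \is Num.real.
  by apply/ger0_real/(le_trans _ (sub _ (ex_intro2 _ _ 0%N I erefl)))/sumr_ge0.
have d_real : d \is Num.real by apply: ger0_real; exact: ltW.
have [N NP] : exists N, s - d < \sum_(0 <= j < N) t i j.
  apply: contrapT => /forallNP nN; have : s <= s - d.
    apply: slb => _ [n _ <-]; rewrite real_leNgt ?rpredB//; first exact/negP/nN.
    by apply: ger0_real; apply: sumr_ge0.
  by rewrite lerDl oppr_ge0 lt_geF.
exists N => n; have [Nn|nN] := leqP N n; last by rewrite big_geq ?(ltW d0)// ltnW.
have := sub _ (ex_intro2 _ _ n I erefl); rewrite (@big_cat_nat _ _ _ N)//= => le.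
have := lt_le_trans (ltr_leD NP (lexx (\sum_(N <= j < n) t i j))) le.
by rewrite -addrA gtrDl addrC subr_lt0 => /ltW.
Qed.

(* Entries below the diagonal are handled by a greedy colouring from below;
   those above it by greedy colourings from above inside finite blocks, two
   blocks of the same parity being so far apart that only a tail remains. *)
Lemma small_on_coloring (d : K) : 0 < d -> exists (X : finType) (c : nat -> X),
  forall A, (forall i j, A i -> A j -> c i = c j) -> small_on d A.
Proof.
(* One third each for the columns below the diagonal, those above it in the same block, and those in
   later blocks. *)
move=> d0; pose e := d / 3; have e0 : 0 < e by rewrite divr_gt0.
have [m mM] := complete_nneg_archi M_ge0 e0.
have small S r : S *+ m.+1 <= r -> r <= M -> S <= e.
  by move=> Sr rM; rewrite -(@ler_pMn2r _ m.+1)// (le_trans Sr)// (le_trans rM).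
have [cl clP] := greedy_coloring m t_ge0.
(* The reflection of indices below [N] turns the greedy colouring from below into one from above. *)
have cuP N : exists cu : nat -> 'I_m.+1, forall i, (i < N)%N ->
    \sum_(i.+1 <= j < N | cu j == cu i) t i j <= e.
  have [c cP] := greedy_coloring m (fun x y => t_ge0 (N - x.+1) (N - y.+1)).
  exists (fun j => c (N - j.+1)%N) => i iN; apply: small (t_row i N).
  apply: le_trans (_ : \sum_(i.+1 <= j < N) t i j <= _); last first.
    by rewrite [leRHS](@big_cat_nat _ _ _ i.+1)//= lerDr sumr_ge0.
  rewrite -[i.+1]add0n !big_addn; have := cP (N - i.+1)%N.
  rewrite big_nat_rev [X in _ <= X]big_nat_rev /= !add0n => le.
  rewrite big_nat_cond [leRHS]big_nat_cond.
  move: le; rewrite big_nat_cond [leRHS]big_nat_cond.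
  have -> : (N - (N - i.+1).+1 = i)%N by lia.
  have E k : (k < N - i.+1)%N -> (N - (N - i.+1 - k.+1).+1 = k + i.+1)%N by lia.
  have E' k : (k < N - i.+1)%N -> (N - i.+1 - k.+1 = N - (k + i.+1).+1)%N by lia.
  congr (_ *+ _ <= _); last by apply: eq_bigr => k /andP[/andP[_ /E ->]].
  apply: eq_big => [k|k /andP[/andP[_ /E ->]]//].
  by case: (ltnP k (N - i.+1)) => //= /E' ->.
have /choice[cu {}cuP] := cuP.
have /choice[f fP] := fun i => row_tail i e0.
(* The tail of a row starting in one block is at most [e] beyond the end of the next block. *)
pose p k := iter k (fun q => (maxn q (\max_(i < q) f i)).+1) 0%N.
have pS k : (p k < p k.+1)%N by rewrite /= ltnS leq_maxl.
have pmono : {homo p : k l / (k <= l)%N}.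
  by apply: (homo_leq leqnn leq_trans) => k; exact: ltnW.
have pf i k : (i < p k)%N -> (f i <= p k.+1)%N.
  move=> ik; rewrite /= leqW// leq_max; apply/orP; right.
  exact: (@leq_bigmax _ (fun i : 'I_(p k) => f i) (Ordinal ik)).
have [b bP] := block_index (erefl : p 0%N = 0%N) pS.
have bmono i j : (i <= j)%N -> (b i <= b j)%N.
  move=> ij; have /andP[+ _] : (p (b i) <= i < p (b i).+1)%N by rewrite -bP.
  have /andP[_] : (p (b j) <= j < p (b j).+1)%N by rewrite -bP.
  move=> jb bi; rewrite leqNgt; apply/negP => /pmono le.
  by have := leq_trans jb (leq_trans le bi); rewrite ltnNge ij.
exists ('I_m.+1 * 'I_m.+1 * bool)%type, (fun j => (cl j, cu (p (b j).+1) j, odd (b j))).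
move=> A Ac i n Ai.
pose q := p (b i).+1; pose q' := p (b i).+2.
have /andP[pi iq] : (p (b i) <= i < q)%N by rewrite -bP.
have -> : d = e + e + e by rewrite /e; field.
apply: (@le_trans _ _ (\sum_(0 <= j < n | (cl j == cl i) && (0 <= j < i)%N) t i j
  + \sum_(0 <= j < n | (cu q j == cu q i) && (i.+1 <= j < q)%N) t i j
  + \sum_(0 <= j < n | true && (q' <= j < n)%N) t i j)).
  rewrite big_mkcond [X in _ <= X + _ + _]big_mkcond.
  rewrite [X in _ <= _ + X + _]big_mkcond [X in _ <= _ + _ + X]big_mkcond.
  rewrite -!big_split /= big_nat_cond [leRHS]big_nat_cond; apply: ler_sum => j /andP[/= jn _].
  case: ifPn => [/set_mem Aj|_]; last by rewrite !addr_ge0//; case: ifP.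
  have [cij ucij bij] := Ac _ _ Ai Aj.
  have [ji|ij|<-] := ltngtP j i; last by rewrite t_diag !addr_ge0//; case: ifP.
    by rewrite cij eqxx/= -addrA lerDl !addr_ge0//; case: ifP.
  have [bE|nb] := eqVneq (b j) (b i).
    have jq : (j < q)%N.
      by have /andP[_] : (p (b j) <= j < p (b j).+1)%N; rewrite ?/q -?bE// -bP.
    rewrite jq andbT; move: ucij; rewrite bE => /esym/eqP -> /=.
    by rewrite addrAC lerDr addr_ge0//; case: ifP.
  (* A different block of the same parity to the right is at least two blocks further. *)
  have q'j : (q' <= j)%N.
    have /andP[pj _] : (p (b j) <= j < p (b j).+1)%N by rewrite -bP.
    apply: leq_trans pj; apply: pmono.
    by have := bmono _ _ (ltnW ij); move: nb bij; lia.
  by rewrite q'j jn lerDr addr_ge0//; case: ifP.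
apply: lerD; first apply: lerD.
- by apply: le_trans (sum_window _ _ _ _ _) _; exact: small (clP i) (t_row _ _).
- by apply: le_trans (sum_window _ _ _ _ _) _; exact: cuP.
- apply: le_trans (sum_window _ _ _ _ _) _ => /=.
  have [q'n|nq'] := leqP q' n; last by rewrite big_geq ?(ltW e0)// ltnW.
  apply: le_trans (fP i n); rewrite (@big_cat_nat _ _ _ q' (f i))//= ?lerDr ?sumr_ge0//.
  exact: pf.
Qed.
End Matrix.

(** * Sparse sets *)

Definition sparse (g : nat -> nat) (n k : nat) := iter k (fun a => maxn a.+1 (g a)) n.

Lemma sparse_mono g n : {homo sparse g n : k l / (k < l)%N}.
Proof. by apply: (homo_ltn ltn_trans) => k; rewrite /= leq_maxl. Qed.

Lemma sparse_infinite g n : infinite_set (range (sparse g n)).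
Proof.
apply/infinite_natP => m; exists (sparse g n m.+1); first by exists m.+1.
have ge k : (k <= sparse g n k)%N by elim: k => // k /leq_ltn_trans; apply; exact: sparse_mono.
exact: ge.
Qed.

Section SparseSmall.
Variables (K : numFieldType) (t : nat -> nat -> K) (M : K).
Hypothesis Ksup : complete_nneg K.
Hypothesis t_ge0 : forall i j, 0 <= t i j.
Hypothesis t_diag : forall i, t i i = 0.
Hypothesis t_row : forall i n, \sum_(0 <= j < n) t i j <= M.
Hypothesis t_col : forall j (e : K), 0 < e -> exists N, forall i, (N <= i)%N -> t i j <= e.

(** Here [f n] is so large that rows from [f n] on are small on the columns up to [n], and rows up
    to [n] are small on the columns from [f n] on. Consecutive elements [a], [a'] of the sparse set
    satisfy [f a <= a']; as all are at least [n], domination from [n] on is enough. *)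
Lemma small_on_sparse (d : K) : 0 < d -> exists f : nat -> nat,
  forall g n, (forall k, (n <= k)%N -> (f k <= g k)%N) -> small_on t d (range (sparse g n)).
Proof.
move=> d0; pose e := d / 2; have e0 : 0 < e by rewrite divr_gt0.
have /choice[ft ftP] := fun i => row_tail Ksup t_ge0 t_row i e0.
have /choice[f fP] : forall n, exists N,
    (forall i, (N <= i)%N -> \sum_(0 <= j < n.+1) t i j <= e) /\
    (forall i m, (i <= n)%N -> \sum_(N <= j < m) t i j <= e).
  move=> n; have en0 : 0 < e / n.+1%:R by rewrite divr_gt0.
  have /choice[fc fcP] := fun j => t_col j en0.
  exists (maxn (\max_(j < n.+1) fc j) (\max_(i < n.+1) ft i)); split=> [i|i m ni].
    rewrite geq_max => /andP[/bigmax_leqP fi _].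
    rewrite big_mkord; apply: (@le_trans _ _ (\sum_(j < n.+1) e / n.+1%:R)).
      by apply: ler_sum => j _; apply: fcP; exact: fi.
    by rewrite sumr_const card_ord -(mulr_natr (e / _)) divfK.
  set N := maxn _ _; have ftN : (ft i <= N)%N.
    rewrite leq_max; apply/orP; right.
    exact: (@leq_bigmax _ (fun i : 'I_n.+1 => ft i) (Ordinal (ni : (i < n.+1)%N))).
  have [Nm|mN] := leqP N m; last by rewrite big_geq ?(ltW e0)// ltnW.
  by apply: le_trans (ftP i m); rewrite (@big_cat_nat _ _ _ N (ft i))//= lerDr sumr_ge0.
exists f => g n fg _ m [k _ <-]; pose a := sparse g n.
have age l : (n <= a l)%N.
  by elim: l => [|l /leq_trans]; [exact: leqnn|apply; exact/ltnW/sparse_mono].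
have fa l : (f (a l) <= a l.+1)%N by rewrite /a /= leq_max fg ?orbT.
have amono : {mono a : k l / (k <= l)%N} := leq_mono (@sparse_mono g n).
have [f1 f2] := fP (a k).
(* [low] is one past the predecessor of [a k], or 0 if there is none. *)
pose low := if k is l.+1 then (a l).+1 else 0%N.
have low_le : \sum_(0 <= j < low) t (a k) j <= e.
  rewrite /low; case: (k) => [|l]; first by rewrite big_geq ?(ltW e0).
  by have [H _] := fP (a l); apply: H; exact: fa.
have -> : d = e + e by rewrite /e; field.
apply: le_trans (_ : \sum_(0 <= j < m) ((if (j < low)%N then t (a k) j else 0) +
                     (if (f (a k) <= j)%N then t (a k) j else 0)) <= _).
  rewrite big_mkcond; apply: ler_sum => j _.
  case: ifPn => [/set_mem[l _ <-]|_]; last by rewrite addr_ge0//; case: ifP.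
  rewrite -/(a l); have [lk|kl|->] := ltngtP l k.
  - have -> : (a l < low)%N.
      by rewrite /low; case: (k) lk => // k' lk'; rewrite ltnS amono.
    by rewrite lerDl; case: ifP.
  - have -> : (f (a k) <= a l)%N by rewrite (leq_trans (fa k))// amono.
    by rewrite lerDr; case: ifP.
  - by rewrite t_diag addr_ge0//; case: ifP.
rewrite big_split -!big_mkcond lerD//=.
  apply: le_trans low_le; rewrite (big_nat_widen 0 m (maxn m low)) ?leq_maxl//.
  rewrite [leRHS](big_nat_widen 0 low (maxn m low)) ?leq_maxr//.
  rewrite [leLHS]big_mkcond [leRHS]big_mkcond; apply: ler_sum => j _.
  by case: (j < low)%N (j < m)%N => [] [] /=.
apply: le_trans (f2 (a k) m (leqnn _)); rewrite [leRHS](big_nat_widenl (f (a k)) 0)//.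
Qed.
End SparseSmall.

(** * Operators on c_0 *)

Section Operators.
Variable K : numFieldType.
Hypothesis Ksup : complete_nneg K.
Implicit Types (f g : c0 K) (T : {linear c0 K -> c0 K}).

Lemma c0_coord_le f n : `|f n| <= `|f|.
Proof. exact: (c0_norm_max f).1. Qed.

Lemma c0_norm_le f b : (forall n, `|f n| <= b) -> `|f| <= b.
Proof. by move=> fb; have [_ [m fm]] := c0_norm_max f; rewrite [leLHS]fm. Qed.

Lemma c0_sumE (s : seq nat) (F : nat -> c0 K) n : (\sum_(j <- s) F j) n = \sum_(j <- s) F j n.
Proof. by elim/big_rec2: _ => // j x y _ <-. Qed.

Lemma c0_scaleE a f n : (a *: f) n = a * f n.
Proof. by []. Qed.

Lemma c0_deltaE k n : c0_delta K k n = (n == k)%:R.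
Proof.
rewrite /= indicE (_ : (n \in [set k]) = (n == k))//.
by apply/idP/eqP => [/set_mem|->]//; exact/mem_set.
Qed.

Lemma c0_delta_norm k : `|c0_delta K k| <= 1.
Proof. by apply: c0_norm_le => n; rewrite c0_deltaE normr_nat lern1 leq_b1. Qed.

Definition c0_trunc (a : nat -> K) n : c0 K := \sum_(0 <= j < n) a j *: c0_delta K j.

Lemma c0_truncE a n k : c0_trunc a n k = if (k < n)%N then a k else 0.
Proof.
rewrite c0_sumE; under eq_bigr => j _ do rewrite c0_scaleE c0_deltaE.
case: ltnP => kn; last first.
  rewrite big_nat_cond big1// => j /andP[/andP[_ jn] _].
  by rewrite gtn_eqF ?mulr0// (leq_trans jn).
rewrite big_mkord (bigD1 (Ordinal kn))//= eqxx mulr1 big1 ?addr0// => j jk.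
by rewrite -[k]/(val (Ordinal kn)) val_eqE eq_sym (negbTE jk) mulr0.
Qed.

Lemma linear_trunc T a n i : T (c0_trunc a n) i = \sum_(0 <= j < n) a j * T (c0_delta K j) i.
Proof.
by rewrite linear_sum c0_sumE; apply: eq_bigr => j _; rewrite linearZ.
Qed.

Definition entries T i j := `|T (c0_delta K j) i|.

Lemma entries_ge0 T i j : 0 <= entries T i j.
Proof. exact: normr_ge0. Qed.

Lemma entries_diag T i : B0 T -> entries T i i = 0.
Proof. by move=> [_ T0]; rewrite /entries T0 normr0. Qed.

(** The operator is tested on the truncated vector of phases [|z| / z], which is 0 where the entry
    vanishes: its norm is at most 1 and its image has the row sum as coordinate [i]. *)
Lemma entries_row T M i n : (forall f, `|T f| <= M * `|f|) ->
  \sum_(0 <= j < n) entries T i j <= M.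
Proof.
move=> TM; have M0 : 0 <= M.
  rewrite -(@pmulr_lge0 _ `|c0_delta K 0|) ?(le_trans _ (TM _))//.
  by apply: lt_le_trans (c0_coord_le _ 0); rewrite c0_deltaE normr1.
pose s j := let z := T (c0_delta K j) i in `|z| / z.
have -> : \sum_(0 <= j < n) entries T i j = T (c0_trunc s n) i.
  rewrite linear_trunc; apply: eq_bigr => j _; rewrite /s /entries.
  by have [->|nz] := eqVneq (T (c0_delta K j) i) 0; rewrite ?normr0 ?mulr0// divfK.
have Ts : `|c0_trunc s n| <= 1.
  apply: c0_norm_le => k; rewrite c0_truncE; case: ifP; rewrite ?normr0// => _.
  rewrite /s normrM normfV normr_id.
  by have [->|nz] := eqVneq (T (c0_delta K k) i) 0; rewrite ?normr0 ?mul0r// divff ?normr_eq0.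
have sum0 : 0 <= T (c0_trunc s n) i.
  rewrite linear_trunc sumr_ge0// => j _; rewrite /s.
  by have [->|nz] := eqVneq (T (c0_delta K j) i) 0; rewrite ?mulr0// divfK.
rewrite -[leLHS]ger0_norm// (le_trans (c0_coord_le _ _))// (le_trans (TM _))//.
by rewrite -[leRHS]mulr1 ler_wpM2l.
Qed.

Lemma entries_col T j (e : K) : 0 < e -> exists N, forall i, (N <= i)%N -> entries T i j <= e.
Proof.
move=> e0; have /cvgr0Pnorm_lt/(_ e e0)[N _ NP] := @c0_cvg _ (T (c0_delta K j)).
by exists N => i /NP/ltW.
Qed.

(** Completeness makes [op_norm] a true least upper bound rather than the default 0. *)
Lemma op_norm_sup (S : c0 K -> c0 K) B : (forall f, `|f| <= 1 -> `|S f| <= B) ->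
  op_norm S <= B /\ forall f, `|f| <= 1 -> `|S f| <= op_norm S.
Proof.
move=> SB; pose X := [set `|S f| | f in [set f | `|f| <= 1]].
have X0 : X !=set0 by exists `|S 0|, 0 => //=; rewrite normr0.
have [s sP] : supremums X !=set0.
  apply: Ksup => //; first by move=> _ [f _ <-] /=.
  by exists B => _ [f f1 <-]; exact: SB.
have -> : op_norm S = s.
  rewrite /op_norm /supremum -/X ifF; last by apply/negbTE/set0P.
  apply: xget_unique => // y yP; apply/le_anti.
  by rewrite (sP.2 _ yP.1) (yP.2 _ sP.1).
split=> [|f f1]; first by apply: sP.2 => _ [f f1 <-]; exact: SB.
by apply: sP.1; exists f.
Qed.

(** [small_on] controls finite sums only, so the restricted vector is truncated; the remainder is
    small in norm, and boundedness of [T] keeps its image small. *)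
Lemma small_on_norm T M A d f : (forall f, `|T f| <= M * `|f|) -> 0 <= d ->
  small_on (entries T) d A -> `|f| <= 1 -> `|c0P A (T (c0P A f))| <= d.
Proof.
move=> TM d0 dA f1; set g := c0P A f.
have gA k : `|g k| <= (k \in A)%:R.
  rewrite /= normrM indicE normr_nat -[leRHS]mul1r ler_wpM2r//.
  exact: le_trans (c0_coord_le _ _) f1.
have M0 : 0 <= M by apply: le_trans (entries_row 0 0 TM); rewrite big_geq.
apply: c0_norm_le => i /=; rewrite normrM indicE normr_nat.
have [/set_mem Ai|_] := boolP (i \in A); last by rewrite mulr0.
rewrite mulr1; apply/ler_addgt0Pl => e e0.
pose e' := e / (M + 1); have M1 : 0 < M + 1 by rewrite ltr_wpDl.
have e'0 : 0 < e' by rewrite divr_gt0.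
have /cvgr0Pnorm_lt/(_ e' e'0)[N _ NP] := @c0_cvg _ g.
pose r := g - c0_trunc g N.
have r_le : `|r| <= e'.
  apply: c0_norm_le => k; rewrite [r k](_ : _ = g k - c0_trunc g N k)// c0_truncE.
  case: ltnP => [_|/NP/ltW]; rewrite ?subrr ?normr0 ?subr0//; exact: ltW.
have -> : T g i = T r i + T (c0_trunc g N) i by rewrite /r linearB /= subrK.
apply: le_trans (ler_normD _ _) _; apply: lerD.
  apply: le_trans (c0_coord_le _ _) (le_trans (TM _) _).
  apply: le_trans (ler_wpM2l M0 r_le) _.
  by rewrite /e' mulrCA ger_pMr// ler_pdivrMr// mul1r lerDl.
rewrite linear_trunc; apply: le_trans (ler_norm_sum _ _ _) (le_trans _ (dA i N Ai)).
rewrite [leRHS]big_mkcond; apply: ler_sum => j _; rewrite normrM.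
have := gA j; case: ifP => _; last first.
  by rewrite normr_le0 => /eqP ->; rewrite normr0 mul0r.
move=> gj; by rewrite -[leRHS]mul1r ler_wpM2r.
Qed.

Lemma Ros_small_on T eps : B0 T -> 0 < eps -> exists2 d, 0 < d &
  forall A, infinite_set A -> small_on (entries T) d A -> Ros T eps A.
Proof.
move=> [[M TM] _] eps0; have M0 : 0 <= M by apply: le_trans (entries_row 0 0 TM); rewrite big_geq.
have [|_ Tle] := @op_norm_sup T M.
  by move=> f f1; rewrite (le_trans (TM f))// -[leRHS]mulr1 ler_wpM2l.
have T0 : 0 <= op_norm T by apply: le_trans (Tle 0 _); rewrite ?normr0.
have Pf A f : `|f| <= 1 -> `|c0P A f| <= 1.
  move=> f1; apply: c0_norm_le => k; apply: le_trans f1.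
  apply: le_trans (c0_coord_le f k).
  by rewrite /= normrM indicE normr_nat ler_piMr//; case: (_ \in _).
(* If [T] has norm 0, it vanishes on the unit ball and any positive [d] will do. *)
have [d0|d0] := eqVneq (op_norm T) 0.
  exists 1 => // A Ainf _; split=> //; rewrite d0 mulr0.
  apply: (op_norm_sup _).1 => f f1 /=.
  have := Tle _ (Pf A f f1); rewrite d0 normr_le0 => /eqP ->.
  by rewrite linear0 normr0.
exists (eps * op_norm T); first by rewrite mulr_gt0// lt0r d0.
move=> A Ainf sA; split=> //; apply: (op_norm_sup _).1 => f f1 /=.
by apply: small_on_norm TM _ sA f1; rewrite mulr_ge0// ltW.
Qed.
End Operators.

(** * The bounds on ros *)

Section Bounds.
Variable K : numFieldType.
Hypothesis Ksup : complete_nneg K.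

(* Instead of all the [range (sparse g n)], those for a single [n] suffice: if
   each [n] failed at some operator, with function [f n], a [g] dominating the
   diagonal maximum of the [f n] from [N] on would not fail for [N]. *)
Lemma dominating_ros (D : set (nat -> nat)) : dominating_family D ->
  exists2 G, ros_family K G & G #<= D.
Proof.
move=> Ddom; pose G n := [set range (sparse g n) | g in D].
suff [n Gn] : exists n, ros_family K (G n) by exists (G n) => //; exact: card_image_le.
apply: contrapT => /forallNP nG.
have /choice[f fP] : forall n, exists f : nat -> nat, forall g,
    (forall k, (n <= k)%N -> (f k <= g k)%N) -> ~ D g.
  move=> n; apply: contrapT => /forallNP nf; apply: (nG n); split.
    by move=> _ [g _ <-]; exact: sparse_infinite.
  move=> T eps T0 eps0; have [d d0 dP] := Ros_small_on Ksup T0 eps0.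
  have [[M TM] _] := T0.
  have [f fP] := small_on_sparse Ksup (entries_ge0 T) (fun i => entries_diag i T0)
    (fun i n => entries_row i n TM) (entries_col T) d0.
  have /existsNP[g /not_implyP[fg /contrapT Dg]] := nf f.
  exists (range (sparse g n)); split; first by exists g.
  by apply: dP; [exact: sparse_infinite|exact: fP].
have [g Dg [N _ NP]] := Ddom (fun k => \max_(n < k.+1) f n k)%N.
apply: (fP N g) Dg => k Nk; apply: leq_trans (NP k Nk).
exact: (@leq_bigmax _ (fun n : 'I_k.+1 => f n k) (Ordinal (Nk : (N < k.+1)%N))).
Qed.

Lemma reaping_ros (F : set (set nat)) : reaping_family F ->
  exists2 G, ros_family K G & G #<= F.
Proof.
move=> /reaping_homogeneous[G [GF Ginf Ghom]]; exists G => //; split=> // T eps T0 eps0.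
have [d d0 dP] := Ros_small_on Ksup T0 eps0; have [[M TM] _] := T0.
have [X [c cP]] := small_on_coloring Ksup (entries_ge0 T) (fun i => entries_diag i T0)
  (fun i n => entries_row i n TM) d0.
have [A GA cA] := Ghom X c; exists A; split=> //.
by apply: dP; [exact: Ginf|exact: cP].
Qed.

(** Since [phi] tends to infinity, composition preserves c_0; since it has no fixed point, the
    diagonal is zero. *)
Lemma composition_operator (phi : nat -> nat) :
  (forall i, phi i != i) -> (forall N, exists N', forall i, (N' <= i)%N -> (N <= phi i)%N) ->
  exists T : {linear c0 K -> c0 K}, B0 T /\ forall f i, T f i = f (phi i).
Proof.
move=> phi_neq phi_inf.
have comp_c0 (f : c0 K) : (fun i => f (phi i) : K^o) \in @c0_pred K.
  apply/c0_predP/cvgr0Pnorm_lt => e e0.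
  have /cvgr0Pnorm_lt/(_ e e0)[N _ NP] := @c0_cvg _ f.
  by have [N' phiN'] := phi_inf N; exists N' => // i /phiN'; exact: NP.
pose S f := C0 (comp_c0 f) : c0 K.
have S_linear : linear S by move=> a f g; exact: c0_eqP.
pose T : {linear c0 K -> c0 K} := HB.pack S (GRing.isLinear.Build K _ _ _ S S_linear).
exists T; split=> //; split; last first.
  by move=> n; rewrite [LHS](c0_deltaE K n (phi n)) (negbTE (phi_neq n)).
by exists 1 => f; rewrite mul1r; apply: c0_norm_le => n; exact: (c0_coord_le f (phi n)).
Qed.

(* Splitting over and over again produces disjoint sets [B n], each of which
   meets every member of [G] in an infinite set. The operator is composition
   with the map sending [B n] to [n], made finite-to-one by the undominated
   function [h]. *)
Lemma ros_dominating_or_reaping (G : set (set nat)) : ros_family K G ->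
  (exists e : set nat -> nat -> nat, dominating_family (e @` G)) \/
  (exists e : set nat -> set nat, reaping_family (e @` G)).
Proof.
move=> [Ginf Gros]; apply: contrapT => /not_orP[/forallNP nD /forallNP nR].
have [nx nxP] := infinite_next.
have /choice[sp spP] : forall R : set nat, exists S, (forall A, G A -> infinite_set (A `&` R)) ->
    forall A, G A -> infinite_set (A `&` R `&` S) /\ infinite_set ((A `&` R) `\` S).
  move=> R; apply: contrapT => /forallNP nS.
  apply: (nR (fun A => A `&` R)); split.
    by move=> _ [A GA <-]; apply: contrapT => fin; apply: (nS set0) => /(_ _ GA).
  move=> [S SP]; apply: (nS S) => _ A GA; apply: SP; exact: imageP.
(* [R n] is what remains after [n] splittings, and [B n] below is the piece cut off from it next. *)
pose R n := iter n (fun X => X `\` sp X) [set: nat].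
have RP n A : G A -> infinite_set (A `&` R n).
  elim: n A => [|n IH] A GA; first by rewrite setIT; exact: Ginf.
  by have [_] := spP _ IH _ GA; rewrite -setIDA.
pose B n := R n `&` sp (R n).
have BP n A : G A -> infinite_set (A `&` B n).
  by move=> GA; have [+ _] := spP _ (RP n) _ GA; rewrite -setIA.
have Rmono m n : (m <= n)%N -> R n `<=` R m.
  elim: n => [|n IH]; first by rewrite leqn0 => /eqP ->.
  by rewrite leq_eqVlt => /predU1P[->//|/IH H] x [/H].
have Bdisj m n i : B m i -> B n i -> m = n.
  have lt k l : (k < l)%N -> B k i -> ~ B l i.
    by move=> /Rmono kl [_ spi] [/kl[_ /(_ spi)]].
  move=> Bm Bn; have [/lt /(_ Bm)/(_ Bn)|/lt /(_ Bn)/(_ Bm)|] := ltngtP m n => //.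
pose w A j := nx (A `&` B j) j.
have wP A j : G A -> [/\ A (w A j), B j (w A j) & (j < w A j)%N].
  by move=> GA; have [[]] := nxP _ j (BP j A GA).
(* Otherwise the functions sending [n] to [w A (nx A n)] would dominate every [f]. *)
have [f fP] : exists f : nat -> nat, forall A, G A -> exists n, (w A (nx A n) <= f n)%N.
  apply: contrapT => /forallNP nf; apply: (nD (fun A n => w A (nx A n))) => f.
  have /existsNP[A /not_implyP[GA /forallNP fA]] := nf f.
  exists (fun n => w A (nx A n)); first by exists A.
  by exists 0%N => // n _; apply/ltnW; rewrite ltnNge; apply/negP/fA.
(* Monotonicity of [h] absorbs the shift from [n] to the element [nx A n] of [A]. *)
pose h n := (\max_(k < n.+1) f k)%N.
have fh k n : (k <= n)%N -> (f k <= h n)%N.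
  by move=> kn; exact: (@leq_bigmax _ (fun k : 'I_n.+1 => f k) (Ordinal (kn : (k < n.+1)%N))).
have hmono m n : (m <= n)%N -> (h m <= h n)%N.
  by move=> mn; apply/bigmax_leqP => k _; apply: fh; apply: leq_trans mn; rewrite -ltnS.
(* The bound [i <= h j] makes [phi] finite-to-one; the default [i.+1] avoids fixed points and tends
   to infinity. *)
pose phi i := xget i.+1 [set j | [/\ B j i, (j < i)%N & (i <= h j)%N]].
have phiP i : phi i = i.+1 \/ [/\ B (phi i) i, (phi i < i)%N & (i <= h (phi i))%N].
  by rewrite /phi; case: xgetP => [j _|_]; [right|left].
have [||T [T0 TE]] := @composition_operator phi.
- by move=> i; case: (phiP i) => [->|[_ lt _]]; [rewrite gtn_eqF|rewrite ltn_eqF].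
- move=> N; exists (maxn N (h N).+1) => i; rewrite geq_max => /andP[Ni hi].
  case: (phiP i) => [->|[_ _ ih]]; first exact: leqW.
  by rewrite leqNgt; apply/negP => /ltnW/hmono; rewrite leqNgt (leq_trans hi).
have [|A [GA [_]]] := Gros T 2^-1 T0; first by rewrite invr_gt0.
have [n fn] := fP A GA; have [Aa na] := nxP A n (Ginf _ GA).
set a := nx A n in fn Aa na; have [Ai Bi ai] := wP A a GA; set i := w A a in fn Ai Bi ai.
have phia : phi i = a.
  apply: xget_unique => [|j [Bj _ _]]; last exact: Bdisj Bj Bi.
  by split=> //; apply: leq_trans fn (fh _ _ (ltnW na)).
have T1 f' : `|f'| <= 1 -> `|T f'| <= 1.
  by move=> f1; apply: c0_norm_le => k; rewrite TE; exact: le_trans (c0_coord_le _ _) f1.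
have [Tn _] := op_norm_sup Ksup T1.
have P1 A' (f' : c0 K) : `|c0P A' f'| <= `|f'|.
  apply: c0_norm_le => k; apply: le_trans (c0_coord_le f' k).
  by rewrite /= normrM indicE normr_nat ler_piMr//; case: (_ \in _).
have [|_ Pn] := @op_norm_sup _ Ksup (c0P A \o T \o c0P A) 1.
  by move=> f' f1 /=; apply: le_trans (P1 _ _) (T1 _ _); exact: le_trans (P1 _ _) f1.
(* The unit vector at [a] is tested at coordinate [i]: both lie in [A], and [phi i = a]. *)
have ge1 : 1 <= op_norm (c0P A \o T \o c0P A).
  apply: le_trans (Pn _ (c0_delta_norm K a)); apply: le_trans (c0_coord_le _ i).
  by rewrite /= TE /= phia !indicE !mem_set// !mulr1 normr1.
move=> /(le_trans ge1) /le_trans/(_ (ler_wpM2l _ Tn)).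
rewrite mulr1 invr_ge0 ler0n => /(_ isT); by rewrite invf_ge1// lern1.
Qed.

End Bounds.

(** * The equality of cardinals *)

Lemma card_setT_min_card T (P : set (set T)) : [set: min_card P] #= min_set P.
Proof. exact: card_setT. Qed.

Lemma ros_numberE (K : numFieldType) : complete_nneg K ->
  [set: ros_number K] #= [set: card_min dominating_number reaping_number].
Proof.
move=> Ksup; have dom0 : dominating_family !=set0.
  by exists setT => f; exists f => //; exists 0%N.
(* All infinite sets together form a reaping family: [S] splits neither itself nor its complement,
   and one of these is infinite. *)
have reap0 : reaping_family !=set0.
  exists [set A | infinite_set A]; split=> // -[S SP].
  have [SA|SA] := pselect (infinite_set S).
    by have [_] := SP S SA; rewrite setDv; apply; exact: finite_set0.
  have [] := SP (~` S); last by rewrite setICl => /(_ (finite_set0 _)).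
  by move=> SC; apply: infinite_nat; rewrite -(setUv S) finite_setU; split=> //; exact: contrapT.
have [Dd Dmin] := min_setP dom0; have [Rd Rmin] := min_setP reap0.
have [G0 G0P G0D] := dominating_ros Ksup Dd; have [G1 G1P G1R] := reaping_ros Ksup Rd.
have [Gd Gmin] := min_setP (ex_intro _ _ G0P : @ros_family K !=set0).
have leD : [set: ros_number K] #<= [set: dominating_number].
  rewrite (card_le_eql (card_setT_min_card _)) (card_le_eqr (card_setT_min_card _)).
  exact: card_le_trans (Gmin _ G0P) G0D.
have leR : [set: ros_number K] #<= [set: reaping_number].
  rewrite (card_le_eql (card_setT_min_card _)) (card_le_eqr (card_setT_min_card _)).
  exact: card_le_trans (Gmin _ G1P) G1R.
have ge : [set: dominating_number] #<= [set: ros_number K] \/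
          [set: reaping_number] #<= [set: ros_number K].
  have [[e eD]|[e eR]] := ros_dominating_or_reaping Ksup Gd; [left|right];
    rewrite (card_le_eql (card_setT_min_card _)) (card_le_eqr (card_setT_min_card _)).
    exact: card_le_trans (Dmin _ eD) (card_image_le _ _).
  exact: card_le_trans (Rmin _ eR) (card_image_le _ _).
rewrite card_eq_le; apply/andP; split; rewrite /card_min; case: asboolP => // le.
  by case: ge => //; exact: card_le_trans.
by case: ge => // ge; case: le; exact: card_le_trans ge leR.
Qed.

Theorem theorem5p3 (R : realType) :
  [set: ros_number R] #=
    [set: card_min dominating_number reaping_number] /\
  [set: ros_number R[i]] #=
    [set: card_min dominating_number reaping_number].
Proof.
split; apply: ros_numberE => A A0; [exact: supremumsR|exact: supremumsC].
Qed.
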